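(* Let $\mathcal{A}=\{H_1,\ldots,H_m\}$ be a linear, essential hyperplane arrangement in $\mathbb{R}^n$ and let $0\le k<n$. Then the $\mathcal{A}$-matroid decomposition $$\mathrm{Gr}(k,n)=\bigsqcup_{\mathfrak{M}\in\mathbf{M}(\mathcal{A})}\Omega_{\mathcal{A}}(\mathfrak{M}),$$ the $\mathcal{A}$-adjoint decomposition $$\mathrm{Gr}(k,n)=\bigsqcup_{P\in L(\mathcal{A}^{(k)})}\mathcal{S}_P,$$ and the refined $\mathcal{A}$-Schubert decomposition $$\mathrm{Gr}(k,n)=\bigsqcup_{\sigma}\Omega_{\mathcal{A}}(\sigma)\qquad(\sigma\text{ ranging over the Schubert symbols of }\mathcal{A})$$ are exactly the same decomposition of the Grassmannian; that is, the set of nonempty strata $\Omega_{\mathcal{A}}(\mathfrak{M})$, the set of nonempty strata $\mathcal{S}_P$, and the set of nonempty strata $\Omega_{\mathcal{A}}(\sigma)$ are one and the same set of subsets of $\mathrm{Gr}(k,n)$.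
   Context: **Arrangements.** A hyperplane arrangement $\mathcal{A}$ in $\mathbb{R}^n$ is a finite set of hyperplanes; linear means that all hyperplanes pass through $0$, essential means $\bigcap_{H\in\mathcal{A}}H=\{0\}$. For any linear arrangement $\mathcal{A}$ in a vector space $V$, the intersection lattice $L(\mathcal{A})$ is the set of all subspaces $\bigcap_{H\in\mathcal{B}}H$, $\mathcal{B}\subseteq\mathcal{A}$ (the empty intersection being $V$), ordered by reverse inclusion: $X\le Y$ iff $Y\subseteq X$. For $X\in L(\mathcal{A})$, $\mathcal{A}$ in $\mathbb{R}^n$, $\mathrm{rank}(X)=n-\dim X$, and $L_k(\mathcal{A})=\{X\in L(\mathcal{A})\mid \mathrm{rank}(X)=k\}$. For $X\in L(\mathcal{A})$ put $X^\circ=X\setminus\bigcup_{Y\in L(\mathcal{A}),\,Y>X}Y$. **Plücker coordinates.** $[n]=\{1,\ldots,n\}$; $\binom{[n]}{k}$ is the set of $k$-subsets of $[n]$; $\mathbb{R}^{\binom{[n]}{k}}$ is the real vector space with coordinates indexed by $\binom{[n]}{k}$. $\mathrm{Gr}(k,n)$ is the set of $k$-dimensional subspaces of $\mathbb{R}^n$. For a $d$-dimensional subspace $U$ of $\mathbb{R}^n$, choose a $d\times n$ matrix $A$ whose row space is $U$ (a matrix representative); for $I\in\binom{[n]}{d}$, $\Delta_I(U)$ is the $d\times d$ minor of $A$ with column set $I$ (the minor is $1$ if $d=0$), and $\Delta(U)=(\Delta_I(U))_I$, which is well defined up to a common nonzero scalar. **$k$-adjoint.** For $0\le k<n$, $X\in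 L_k(\mathcal{A})$, $I\in\binom{[n]}{k}$, let $a_I(X)=(-1)^{\frac12k(k+1)+\sum_{i\in I}i}\Delta_{[n]\setminus I}(X)$. Let $H(X)=\{(x_I)_I\in\mathbb{R}^{\binom{[n]}{k}}\mid\sum_I a_I(X)x_I=0\}$, and let $\mathcal{A}^{(k)}=\{H(X)\mid X\in L_k(\mathcal{A})\}$, a hyperplane arrangement in $\mathbb{R}^{\binom{[n]}{k}}$. **$\mathcal{A}$-adjoint strata.** For $P\in L(\mathcal{A}^{(k)})$, $\mathcal{S}_P=\{U\in\mathrm{Gr}(k,n)\mid\Delta(U)\in P^\circ\}$. **$\mathcal{A}$-matroid strata.** Let $\alpha_i$ be a normal vector of $H_i$, so $H_i=\{v\mid\langle\alpha_i,v\rangle=0\}$ for the standard inner product. For $U\in\mathrm{Gr}(k,n)$ let $\beta_i$ be the orthogonal projection of $\alpha_i$ to $U$, and let $\mathfrak{M}_{\mathcal{A}}(U)$ be the matroid on $[m]$ with rank function $\mathrm{rank}(I)=\dim\mathrm{span}\{\beta_i\mid i\in I\}$. Let $\mathbf{M}(\mathcal{A})=\{\mathfrak{M}_{\mathcal{A}}(U)\mid U\in\mathrm{Gr}(k,n)\}$ and, for $\mathfrak{M}\in\mathbf{M}(\mathcal{A})$, $\Omega_{\mathcal{A}}(\mathfrak{M})=\{U\in\mathrm{Gr}(k,n)\mid\mathfrak{M}_{\mathcal{A}}(U)=\mathfrak{M}\}$ (equality of matroids on $[m]$). **Refined $\mathcal{A}$-Schubert strata.** For a complete flag $\boldsymbol{F}\colon\{0\}=F_0\subsetneq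 F_1\subsetneq\cdots\subsetneq F_n=\mathbb{R}^n$ with $\dim F_i=i$ and $\tau=\{i_1<\cdots<i_k\}\subseteq[n]$, the Schubert cell is $\Omega_{\boldsymbol{F}}(\tau)=\{U\in\mathrm{Gr}(k,n)\mid\dim(U\cap F_{i_l})>\dim(U\cap F_{i_l-1}),\ 1\le l\le k\}$. Every maximal chain of $L(\mathcal{A})$ is such a flag; let $\mathbf{mc}(L(\mathcal{A}))$ be the set of maximal chains. A Schubert symbol of $\mathcal{A}$ is a map $\sigma\colon\mathbf{mc}(L(\mathcal{A}))\to\binom{[n]}{k}$ such that $\Omega_{\mathcal{A}}(\sigma):=\bigcap_{\boldsymbol{F}\in\mathbf{mc}(L(\mathcal{A}))}\Omega_{\boldsymbol{F}}(\sigma(\boldsymbol{F}))\ne\varnothing$. *)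

(* Defs.v *)
From HB Require Import structures.
From mathcomp Require Import all_boot all_order all_algebra.
From mathcomp Require Import finmap.
From mathcomp Require Import boolp classical_sets reals.
Set Implicit Arguments.
Unset Strict Implicit.
Unset Printing Implicit Defensive.
Import Order.TTheory GRing.Theory Num.Theory.
Local Open Scope ring_scope.

Section Arrangements.
Variables (R : realType) (V : vectType R).
Implicit Types (A C : {fset {vspace V}}) (X Y H : {vspace V}).

Definition is_hyperplane H : bool := (\dim H).+1 == \dim {:V}.

Definition essential A : Prop := (\bigcap_(H <- A) H)%VS = 0%VS.

Definition intersection_lattice A : {fset {vspace V}} :=
  [fset (\bigcap_(H <- (B : {fset {vspace V}})) H)%VS | B in fpowerset A]%fset.

Definition rank_flats A (k : nat) : {fset {vspace V}} :=
  [fset X in intersection_lattice A | (\dim {:V} - \dim X)%N == k]%fset.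

(* The order of the lattice is reverse inclusion, so [Y > X] means that [Y] is
   properly contained in [X]. *)
Definition open_stratum A X : set V :=
  ([set` X] `\` \bigcup_(Y in [set Y : {vspace V} |
      (Y \in intersection_lattice A) && ((Y <= X)%VS && (Y != X))]) [set` Y])%classic.

Definition chains A : {fset {fset {vspace V}}} :=
  [fset C in fpowerset (intersection_lattice A) |
     all2rel (fun X Y => (X <= Y)%VS || (Y <= X)%VS) C]%fset.

Definition max_chains A : {fset {fset {vspace V}}} :=
  [fset C in chains A | ~~ has (fun D => (C `<` D)%fset) (chains A)]%fset.

Definition complete_flag (F : nat -> {vspace V}) : Prop :=
  (forall i, (i <= \dim {:V})%N -> \dim (F i) = i) /\
  (forall i, (i < \dim {:V})%N -> (F i <= F i.+1)%VS).

(* The member of dimension [i] of a maximal chain; [max_chain_flag] below shows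
   that these members form a complete flag and exhaust the chain. *)
Definition chain_flag C (i : nat) : {vspace V} :=
  nth 0%VS [seq X <- C | \dim X == i] 0.

End Arrangements.

(* The index type of R^binom([n], k); an element [i] of ['I_n] stands for the
   element [i + 1] of [n] = {1, ..., n}. *)
Notation ksubset n k := {I : {set 'I_n} | #|I| == k}.

Section Grassmannian.
Variables (R : realType) (n : nat).
Local Notation E := ('rV[R]_n).
Implicit Types (A : {fset {vspace E}}) (U X : {vspace E}) (u v : E).

Definition Gr (k : nat) : set {vspace E} := [set U | \dim U = k]%classic.

(* The minor with column set [I] of the matrix whose rows are the members of
   [s]; it is the usual minor only when [#|I| = size s]. *)
Definition minor (s : seq E) (I : {set 'I_n}) : R :=
  \det (\matrix_(i < #|I|, j < #|I|) s`_i 0 (enum_val j)).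

(* [minor_basis] below: another basis of [U] gives the same coordinates up to
   a common nonzero scalar. *)
Definition plucker U (I : {set 'I_n}) : R := minor (vbasis U) I.

Definition plucker_vec (k : nat) U : {ffun ksubset n k -> R^o} :=
  [ffun I => plucker U (val I)].

Definition adjoint_coef (k : nat) X (I : ksubset n k) : R :=
  (-1) ^+ ((k * k.+1) %/ 2 + \sum_(i in val I) i.+1)%N * plucker X (~: val I).

Definition adjoint_form (k : nat) X (x : {ffun ksubset n k -> R^o}) : R^o :=
  \sum_I adjoint_coef X I * x I.

Definition adjoint_hyperplane (k : nat) X : {vspace {ffun ksubset n k -> R^o}} :=
  lker (linfun (@adjoint_form k X)).

Definition adjoint (k : nat) A : {fset {vspace {ffun ksubset n k -> R^o}}} :=
  [fset adjoint_hyperplane k X | X in rank_flats A k]%fset.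

Definition adjoint_stratum (k : nat) A
    (P : {vspace {ffun ksubset n k -> R^o}}) : set {vspace E} :=
  [set U | Gr k U /\ open_stratum (adjoint k A) P (plucker_vec k U)]%classic.

Definition dotp u v : R^o := \sum_i u 0 i * v 0 i.

Definition normal_vector (a : E) (H : {vspace E}) : Prop :=
  forall v, (v \in H) = (dotp a v == 0).

Definition orthv U : {vspace E} :=
  (\bigcap_(i < \dim U) lker (linfun (dotp (vbasis U)`_i)))%VS.

Definition orthoproj U : E -> E := daddv_pi U (orthv U).

Definition schubert_cell (k : nat) (F : nat -> {vspace E}) (tau : ksubset n k) :
    set {vspace E} :=
  [set U | Gr k U /\
     forall i : 'I_n, i \in val tau ->
       (\dim (U :&: F i) < \dim (U :&: F i.+1))%N]%classic.

Definition schubert_stratum (k : nat) A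
    (sigma : {ffun max_chains A -> ksubset n k}) : set {vspace E} :=
  (\bigcap_(C in [set: max_chains A])
      schubert_cell (chain_flag (val C)) (sigma C))%classic.

Definition schubert_symbols (k : nat) A :
    set {ffun max_chains A -> ksubset n k} :=
  [set sigma | schubert_stratum sigma !=set0]%classic.

End Grassmannian.

Definition is_matroid_rank (m : nat) (r : {ffun {set 'I_m} -> nat}) : bool :=
  [&& [forall I : {set 'I_m}, (r I <= #|I|)%N],
      [forall I : {set 'I_m}, forall J : {set 'I_m},
         (I \subset J) ==> (r I <= r J)%N]
    & [forall I : {set 'I_m}, forall J : {set 'I_m},
         (r (I :|: J) + r (I :&: J) <= r I + r J)%N]].

Record matroid (m : nat) := Matroid {
  matroid_rank :> {ffun {set 'I_m} -> nat};
  _ : is_matroid_rank matroid_rank }.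

Section MatroidStrata.
Variables (R : realType) (n m : nat).
Local Notation E := ('rV[R]_n).
Implicit Types (alpha : 'I_m -> E) (U : {vspace E}).

Definition proj_rank alpha U : {ffun {set 'I_m} -> nat} :=
  [ffun I : {set 'I_m} => \dim <<[seq orthoproj U (alpha i) | i in I]>>].

Fact proj_rank_subproof alpha U : is_matroid_rank (proj_rank alpha U).
Proof.
have monoI (I J : {set 'I_m}) : I \subset J ->
    (<<[seq orthoproj U (alpha i) | i in I]>> <=
     <<[seq orthoproj U (alpha i) | i in J]>>)%VS.
  move=> sIJ; apply: sub_span => x /mapP[i]; rewrite mem_enum => iI ->.
  by apply: map_f; rewrite mem_enum (fintype.subsetP sIJ).
apply/and3P; split.
- apply/forallP => I; rewrite ffunE; apply: leq_trans (dim_span _) _.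
  by rewrite size_map -cardE.
- apply/forallP => I; apply/forallP => J; apply/implyP => sIJ.
  by rewrite !ffunE; apply: dimvS; apply: monoI.
- apply/forallP => I; apply/forallP => J; rewrite !ffunE.
  rewrite -[leqRHS]dimv_sum_cap; apply: leq_add; apply: dimvS; last first.
    by rewrite subv_cap !monoI ?finset.subsetIl ?finset.subsetIr.
  apply/span_subvP => x /mapP[i]; rewrite mem_enum inE => /orP[] iI ->.
    by apply: (subvP (addvSl _ _)); apply/memv_span/map_f; rewrite mem_enum.
  by apply: (subvP (addvSr _ _)); apply/memv_span/map_f; rewrite mem_enum.
Qed.

Definition proj_matroid alpha U : matroid m :=
  Matroid (proj_rank_subproof alpha U).

Definition proj_matroids (k : nat) alpha : set (matroid m) :=
  (proj_matroid alpha @` @Gr R n k)%classic.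

Definition matroid_stratum (k : nat) alpha (M : matroid m) : set {vspace E} :=
  [set U | Gr k U /\ proj_matroid alpha U = M]%classic.

End MatroidStrata.

Definition decomposition (T I : Type) (G : set T) (D : set I)
    (F : I -> set T) : Prop :=
  cover D F = G /\ trivIset D F.

Definition nonempty_strata (T I : Type) (D : set I) (F : I -> set T) :
    set (set T) :=
  [set S | S !=set0 /\ exists2 i, D i & F i = S]%classic.

Section Facts.
Variables (R : realType).

Section Minor.
Variable n : nat.
Local Notation E := ('rV[R]_n).

Lemma minor_basis (U : {vspace E}) (s : seq E) : basis_of U s ->
  exists2 c : R, c != 0 & forall I : {set 'I_n}, #|I| = \dim U ->
    minor s I = c * plucker U I.
Proof.
move=> sU; have size_s : size s == \dim U by rewrite (size_basis (X := in_tuple s)).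
pose t := Tuple size_s; have tU : basis_of U t by [].
pose C := \matrix_(i < \dim U, j < \dim U) coord (vbasis U) j t`_i.
pose D := \matrix_(i < \dim U, j < \dim U) coord t j (vbasis U)`_i.
have memt i : (i < \dim U)%N -> t`_i \in U.
  by move=> lti; apply: basis_mem tU _; rewrite mem_nth ?size_tuple.
have memv i : (i < \dim U)%N -> (vbasis U)`_i \in U.
  by move=> lti; apply: vbasis_mem; rewrite mem_nth ?size_tuple.
have tE i : (i < \dim U)%N ->
    t`_i = \sum_j coord (vbasis U) j t`_i *: (vbasis U)`_j.
  by move=> lti; apply: coord_basis (vbasisP U) (memt i lti).
have CD : C *m D = 1%:M.
  apply/matrixP => i j; rewrite !mxE.
  have <- : coord t j t`_i = (i == j)%:R.
    by rewrite (coord_free i j (basis_free tU)).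
  rewrite [in RHS](tE i) // linear_sum /=; apply: eq_bigr => l _.
  by rewrite !mxE linearZ.
exists (\det C).
  apply/eqP => C0; have := congr1 determinant CD.
  by rewrite det_mulmx C0 mul0r det1 => /esym/eqP; rewrite oner_eq0.
move=> I; rewrite /plucker /minor.
move: (@enum_val _ (mem I)); move: #|_| => d f dU.
have castdet q (e : d = q) (M : 'M[R]_q) :
    \det M = \det (\matrix_(i < d, j < d) M (cast_ord e i) (cast_ord e j)).
  case: q / e M => M; congr (\det _); apply/matrixP => i j.
  by rewrite mxE !cast_ord_id.
rewrite (castdet _ dU C) -det_mulmx; congr (\det _); apply/matrixP => i j; rewrite !mxE.
rewrite -[s]/(tval t) (tE i) -?dU // summxE.
rewrite (reindex (cast_ord dU)) /=; last first.
  by exists (cast_ord (esym dU)) => ? _; rewrite (cast_ordK, cast_ordKV).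
by apply: eq_bigr => l _; rewrite !mxE.
Qed.

End Minor.

Lemma mem_adjoint_hyperplane n k (X : {vspace 'rV[R]_n})
    (x : {ffun ksubset n k -> R^o}) :
  (x \in adjoint_hyperplane k X) = (\sum_I adjoint_coef X I * x I == 0).
Proof.
have lin : linear (@adjoint_form R n k X).
  move=> a u v; rewrite /adjoint_form scaler_sumr -big_split /=.
  by apply: eq_bigr => I _; rewrite !ffunE mulrDr mulrCA.
pose m := GRing.isLinear.Build _ _ _ _ (@adjoint_form R n k X) lin.
pose f : {linear _ -> _} := HB.pack (@adjoint_form R n k X) m.
by rewrite memv_ker (lfunE f).
Qed.

Section Ortho.
Variable n : nat.
Local Notation E := ('rV[R]_n).
Implicit Types (u v w : E) (U : {vspace E}).

Lemma dotp_linear u : linear (dotp u).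
Proof.
move=> a v w; rewrite /dotp scaler_sumr -big_split /=.
by apply: eq_bigr => i _; rewrite !mxE mulrDr mulrCA.
Qed.
HB.instance Definition _ u :=
  GRing.isLinear.Build R E R^o _ (dotp u) (dotp_linear u).

Lemma dotpC u v : dotp u v = dotp v u.
Proof. by apply: eq_bigr => i _; rewrite mulrC. Qed.

Lemma dotp_eq0 u : (dotp u u == 0) = (u == 0).
Proof.
apply/eqP/eqP => [u0|->]; last first.
  by rewrite /dotp big1 // => i _; rewrite mxE mul0r.
apply/rowP => i; rewrite mxE; apply/eqP; rewrite -sqrf_eq0 expr2.
by apply/eqP; apply: (psumr_eq0P _ u0) => // j _; rewrite -expr2 sqr_ge0.
Qed.

Lemma orthvP U v : reflect (forall u, u \in U -> dotp u v = 0) (v \in orthv U).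
Proof.
rewrite memvE; apply: (iffP subv_bigcapP) => [vU u uU | vU i _].
  have vi i : dotp (vbasis U)`_i v = 0.
    have [lti|gei] := ltnP i (\dim U); last first.
      by rewrite nth_default ?size_tuple // dotpC linear0.
    by have := vU (Ordinal lti) isT; rewrite -memvE memv_ker lfunE => /eqP.
  rewrite (coord_vbasis uU) dotpC linear_sum /= big1 // => i _.
  by rewrite linearZ /= dotpC vi scaler0.
rewrite -memvE memv_ker lfunE /= vU //.
by apply: vbasis_mem; rewrite mem_nth ?size_tuple.
Qed.

Lemma capv_orthv U : (U :&: orthv U = 0)%VS.
Proof.
apply/eqP; rewrite -subv0; apply/subvP => v; rewrite memv_cap memv0.
by case/andP => vU /orthvP/(_ v vU)/eqP; rewrite dotp_eq0.
Qed.

Lemma dim_orthv U : (n <= \dim U + \dim (orthv U))%N.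
Proof.
suff dimW d : (n <= d + \dim (\bigcap_(i < d) lker (linfun (dotp (vbasis U)`_i))))%N.
  exact: dimW.
elim: d => [|d IHd].
  by rewrite big_ord0 dimvf add0n dim_matrix mul1r.
rewrite big_ord_recr /=; set W := (\bigcap_(i < d) _)%VS in IHd *.
apply: leq_trans IHd _; rewrite addSnnS leq_add2l.
rewrite -(limg_ker_dim (linfun (dotp (vbasis U)`_d)) W) addnC.
rewrite -[X in (_ <= X)%N]add1n leq_add2r.
by apply: leq_trans (dimvS (subvf _)) _; rewrite dimvf.
Qed.

Lemma addv_orthv U : (U + orthv U = fullv)%VS.
Proof.
apply/eqP; rewrite eqEdim subvf dimvf dim_matrix mul1r.
by rewrite dimv_disjoint_sum ?capv_orthv // dim_orthv.
Qed.

Lemma orthoproj_mem U v : orthoproj U v \in U.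
Proof. exact: memv_pi. Qed.

Lemma orthoproj_orth U v u : u \in U -> dotp u (v - orthoproj U v) = 0.
Proof.
suff /orthvP : v - orthoproj U v \in orthv U by apply.
have /(daddv_pi_add (capv_orthv U)) {1}<- : v \in (U + orthv U)%VS.
  by rewrite addv_orthv memvf.
by rewrite addrC addKr memv_pi.
Qed.

End Ortho.

Section Chains.
Variable V : vectType R.
Implicit Types (A C D : {fset {vspace V}}) (X Y Z W : {vspace V}).

Lemma flatP A X :
  reflect (exists2 B : {fset {vspace V}}, (B `<=` A)%fset &
             X = (\bigcap_(H <- B) H)%VS)
          (X \in intersection_lattice A).
Proof.
apply: (iffP (imfsetP _ _ _ _)) => /= -[B]; first by rewrite fpowersetE; exists B.
by move=> sBA ->; exists B; rewrite // fpowersetE.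
Qed.

Lemma flatT A : fullv \in intersection_lattice A.
Proof. by apply/flatP; exists fset0; rewrite ?fsub0set // big_seq_fset0. Qed.

Lemma subv_bigcapE (s : seq {vspace V}) Y :
  (Y <= \bigcap_(H <- s) H)%VS = all (fun H => (Y <= H)%VS) s.
Proof.
by elim: s => [|H s IHs]; rewrite (big_nil, big_cons) ?subvf //= subv_cap IHs.
Qed.

Lemma bigcapv_le (s : seq {vspace V}) H : H \in s -> (\bigcap_(K <- s) K <= H)%VS.
Proof.
by move=> Hs; have := subvv (\bigcap_(K <- s) K); rewrite subv_bigcapE => /allP; apply.
Qed.

Lemma flat_capH A X H : X \in intersection_lattice A -> H \in A ->
  (X :&: H)%VS \in intersection_lattice A.
Proof.
case/flatP => B sBA -> HA; apply/flatP; exists (H |` B)%fset.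
  by apply/fsubsetP => Y /fset1UP[->|/(fsubsetP sBA)].
apply/eqP; rewrite eqEsubv subv_cap !subv_bigcapE; apply/and3P; split.
- apply/allP => K /fset1UP[->|KB]; first exact: capvSr.
  by apply: subv_trans (capvSl _ _) _; apply: bigcapv_le.
- by apply/allP => K KB; apply: bigcapv_le; apply/fset1UP; right.
- by apply: bigcapv_le; apply/fset1UP; left.
Qed.

Lemma max_chain_flag A C :
    (forall H, H \in A -> is_hyperplane H) -> essential A ->
    C \in max_chains A ->
  complete_flag (chain_flag C) /\
  (forall X, X \in C <->
             exists2 i, (i <= \dim {:V})%N & X = chain_flag C i).
Proof.
move=> hypA essA; rewrite /max_chains /chains !inE /=.
case/andP => /andP[]; rewrite fpowersetE => /fsubsetP sCL /allrelP chC maxC.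
have addC Z : Z \in intersection_lattice A ->
    (forall W, W \in C -> (W <= Z)%VS || (Z <= W)%VS) -> Z \in C.
  move=> ZL cmpZ; apply: contraR maxC => ZC; apply/hasP; exists (Z |` C)%fset.
    rewrite !inE /= fpowersetE; apply/andP; split.
      by apply/fsubsetP => Y /fset1UP[->|/sCL].
    apply/allrelP => X Y /fset1UP[->|XC] /fset1UP[->|YC].
    - by rewrite subvv.
    - by rewrite orbC cmpZ.
    - exact: cmpZ.
    - exact: chC.
  by rewrite fproperEneq fsubsetU1 andbT; apply: contraNneq ZC => ->; rewrite fset1U1.
have CT : fullv \in C by apply: addC => [|W _]; rewrite ?flatT ?subvf.
have C0 : 0%VS \in C.
  by apply: addC => [|W _]; [apply/flatP; exists A | rewrite sub0v orbT].
have eqC X Y : X \in C -> Y \in C -> (\dim X <= \dim Y)%N -> (X <= Y)%VS.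
  move=> XC YC dXY; have /orP[//|sYX] := chC X Y XC YC.
  by have /eqP -> : Y == X by rewrite eqEdim sYX.
have exC j : (j <= \dim {:V})%N -> exists2 X, X \in C & \dim X = (\dim {:V} - j)%N.
  elim: j => [|j IHj] ltj; first by exists fullv; rewrite ?subn0.
  have [X XC dX] := IHj (ltnW ltj).
  set i := (\dim {:V} - j.+1)%N; have dXi : \dim X = i.+1 by rewrite dX subnSK.
  pose P d := has (fun W => (\dim W == d) && (d <= i)%N) C.
  have P0 : exists d, P d by exists 0%N; apply/hasP; exists 0%VS; rewrite ?dimv0 ?eqxx.
  have Pi d : P d -> (d <= i)%N by case/hasP => W _ /andP[].
  have [d /hasP[Y YC /andP[/eqP dY ldi]] maxd] := ex_maxnP P0 Pi.
  have nXY : ~~ (X <= Y)%VS.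
    by apply/negP => /dimvS; rewrite dXi dY leqNgt ltnS ldi.
  have sYX : (Y <= X)%VS by apply: eqC; rewrite // dXi dY leqW.
  have [B sBA YE] := flatP _ _ (sCL _ YC).
  move: nXY; rewrite YE subv_bigcapE => /allPn[H HB nXH].
  have HA : H \in A by apply: (fsubsetP sBA).
  have sYH : (Y <= H)%VS by rewrite YE; apply: bigcapv_le.
  have dZ : \dim (X :&: H) = i.
    apply/eqP; rewrite eqn_leq -ltnS -dXi; apply/andP; split.
      rewrite ltnNge; apply: contra nXH => dXZ.
      have /eqP <- : (X :&: H)%VS == X by rewrite eqEdim capvSl.
      exact: capvSr.
    rewrite -ltnS -dXi; have := dimv_sum_cap X H => dS.
    have := dimvS (subvf (X + H)); rewrite -(eqP (hypA H HA)) => dS'.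
    by rewrite -(leq_add2r (\dim H)) -dS addSnnS addnC leq_add2l.
  exists (X :&: H)%VS => //; apply: addC => [|W WC].
    exact: flat_capH (sCL _ XC) HA.
  have [leW|gtW] := leqP (\dim W) i.
    apply/orP; left; have : (W <= Y)%VS.
      by apply: eqC => //; rewrite dY; apply: maxd; apply/hasP; exists W; rewrite ?eqxx.
    by move/subv_trans; apply; rewrite subv_cap sYX.
  apply/orP; right; apply: subv_trans (capvSl _ _) _.
  by apply: eqC; rewrite // dXi.
have flagC i : (i <= \dim {:V})%N -> chain_flag C i \in C /\ \dim (chain_flag C i) = i.
  move=> lei; have [X XC dX] := exC _ (leq_subr i (\dim {:V})).
  rewrite subKn // in dX.
  have : chain_flag C i \in [seq X <- C | \dim X == i].
    apply: mem_nth; rewrite size_filter -has_count; apply/hasP.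
    by exists X; rewrite ?dX.
  by rewrite mem_filter => /andP[/eqP].
split; [split=> i lei|move=> X].
- by case: (flagC i lei).
- have [C1 d1] := flagC i (ltnW lei); have [C2 d2] := flagC _ lei.
  by apply: eqC; rewrite ?d1 ?d2.
split=> [XC|[i lei ->]]; last by case: (flagC i lei).
have leX := dimvS (subvf X); exists (\dim X) => //.
have [C1 d1] := flagC _ leX.
by apply/eqP; rewrite eqEsubv !eqC ?d1.
Qed.

End Chains.
End Facts.

(* Main.v *)
(** For a [k]-space [U], each of the three strata containing [U] is determined by
    the dimensions of [U :&: X], for [X] in the intersection lattice.
    - The rank in the matroid of [U] of an index set is the codimension in [U] of
      the intersection of [U] with the corresponding flat.
    - The Schubert cell of [U] for a complete flag records the steps of the flag at
      which its intersection with [U] grows, and every flat is on a maximal chain.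
    - By the Laplace expansion along the first [k] rows, the Plücker vector of [U]
      lies on [H(X)] iff [U] meets [X] nontrivially. A [k]-set [B] is a basis of the
      matroid of [U] iff the flat of [B] has rank [k] and meets [U] trivially, so
      the set of such [X] determines the bases of the matroid, hence its rank
      function. *)
Require Import Defs.
From mathcomp Require Import all_boot all_order all_fingroup all_algebra.
From mathcomp Require Import finmap zify.
From mathcomp Require Import boolp classical_sets reals.
Set Implicit Arguments.
Unset Strict Implicit.
Unset Printing Implicit Defensive.
Import Order.TTheory GRing.Theory Num.Theory.
Local Open Scope ring_scope.

(** * Laplace expansion along the first [k] rows, with explicit signs *)

Section Laplace.
Variables (R : comNzRingType) (k p : nat) (x0 : 'I_(k + p)).
Local Notation n := (k + p)%N.
Local Notation sel f := (rowsub f (1%:M : 'M[R]_n)).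
Implicit Types (A : 'M[R]_(k, n)) (B : 'M[R]_(p, n)) (I J : {set 'I_n}).

(** Multilinearity in the rows of [A]: row [i] of [sel f] is the unit vector at [f i]. In the
    Leibniz formula each upper entry is written as a sum over [j] against a Kronecker delta, and the
    product of sums is distributed. *)
Lemma det_col_mx_ffun A B :
  \det (col_mx A B) = \sum_(f : {ffun 'I_k -> 'I_n})
     (\prod_i A i (f i)) * \det (col_mx (sel f) B).
Proof.
under eq_bigr do rewrite big_distrr /=.
rewrite exchange_big; apply: eq_bigr => s _ /=.
rewrite big_split_ord /=.
under eq_bigr do rewrite col_mxEu; rewrite mulrA.
transitivity ((-1) ^+ s * (\prod_i \sum_j A i j * (j == s (lshift p i))%:R) *
    \prod_i (col_mx A B) (rshift k i) (s (rshift k i))).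
  congr (_ * _ * _); apply: eq_bigr => i _.
  rewrite (bigD1 (s (lshift p i))) //= eqxx mulr1 big1 ?addr0 // => j /negPf->.
  by rewrite mulr0.
rewrite bigA_distr_bigA big_distrr big_distrl /=; apply: eq_bigr => f _.
rewrite big_split /= big_split_ord /= mulrCA -!mulrA; congr (_ * (_ * _)).
by congr (_ * _); apply: eq_bigr => i _; rewrite ?col_mxEu ?col_mxEd ?mxE.
Qed.

Lemma det_col_mx_row_perm (s : 'S_k) A B :
  \det (col_mx (row_perm s A) B) = (-1) ^+ s * \det (col_mx A B).
Proof.
have -> : col_mx (row_perm s A) B = block_mx (perm_mx s) 0 0 1%:M *m col_mx A B.
  by rewrite mul_block_col !mul0mx addr0 add0r mul1mx row_permE.
by rewrite det_mulmx det_lblock det1 mulr1 det_perm.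
Qed.

Lemma det_col_mx_selN (f : {ffun 'I_k -> 'I_n}) B :
  ~~ injectiveb f -> \det (col_mx (sel f) B) = 0.
Proof.
case/injectivePn => i [j nij fij].
apply: (@determinant_alternate _ _ _ (lshift p i) (lshift p j)).
  by rewrite (inj_eq (@lshift_inj _ _)).
by move=> l; rewrite !col_mxEu !mxE fij.
Qed.

(** The increasing enumeration of [I]. The domain is ['I_q] rather than ['I_#|I|], which avoids
    casts; the default [x0] is never reached when [#|I| = q]. *)
Definition enumf q I (i : 'I_q) : 'I_n := nth x0 (enum I) i.

Lemma enumf_mem q I (i : 'I_q) : #|I| = q -> enumf I i \in I.
Proof. by move=> cI; rewrite -mem_enum mem_nth // -cardE cI. Qed.

Lemma enumf_inj q I : #|I| = q -> injective (@enumf q I).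
Proof.
move=> cI i j /eqP; rewrite nth_uniq ?enum_uniq -?cardE ?cI //.
by move/eqP/val_inj.
Qed.

Lemma enumf_surj q I x : #|I| = q -> x \in I -> exists i : 'I_q, enumf I i = x.
Proof.
move=> cI xI; have ltx : (index x (enum I) < q)%N.
  by rewrite -cI cardE index_mem mem_enum.
by exists (Ordinal ltx); rewrite /enumf nth_index ?mem_enum.
Qed.

(** Allows a sum over the injective maps with image [I] to be reindexed by permutations. *)
Lemma image_enumf I (f : {ffun 'I_k -> 'I_n}) : #|I| = k ->
  (f \in [set [ffun i => enumf I (s i)] | s : 'S_k]) =
  injectiveb f && (f @: 'I_k == I).
Proof.
move=> cI; apply/imsetP/andP => [[s _ ->]|[/injectiveP injf /eqP imf]].
  have inje : injective [ffun i => enumf I ((s : 'S_k) i)].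
    by move=> i j; rewrite !ffunE => /(enumf_inj cI)/perm_inj.
  split; first exact/injectiveP.
  rewrite eqEcard card_imset // card_ord cI leqnn andbT.
  by apply/fintype.subsetP => _ /imsetP[i _ ->]; rewrite ffunE enumf_mem.
have [g fg] : exists g : 'I_k -> 'I_k, forall i, enumf I (g i) = f i.
  apply: (@fin_all_exists _ _ (fun i j => enumf I j = f i)) => i.
  by apply: enumf_surj => //; rewrite -imf imset_f.
have injg : injective g by move=> i j /(congr1 (@enumf k I)); rewrite !fg => /injf.
by exists (perm injg) => //; apply/ffunP => i; rewrite ffunE permE fg.
Qed.

(** Non-injective maps contribute a matrix with two equal rows. The injective ones are grouped by
    image; for a fixed image, sorting the unit rows produces the signs that turn the inner sum into
    a minor of [A]. *)
Lemma det_col_mx_sets A B :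
  \det (col_mx A B) = \sum_(I : {set 'I_n} | #|I| == k)
     \det (colsub (@enumf k I) A) * \det (col_mx (sel (@enumf k I)) B).
Proof.
rewrite det_col_mx_ffun (bigID (fun f : {ffun _} => injectiveb f)) /= addrC.
rewrite big1 ?add0r => [|f nf]; last by rewrite det_col_mx_selN ?mulr0.
rewrite (partition_big (fun f : {ffun 'I_k -> 'I_n} => f @: 'I_k)
  (fun I => #|I| == k)) /=; last first.
  by move=> f /injectiveP injf; rewrite card_imset // card_ord.
apply: eq_bigr => I /eqP cI.
under eq_bigl do rewrite -image_enumf //.
rewrite big_imset /=; last first.
  move=> s t _ _ /ffunP est; apply/permP => i.
  by have := est i; rewrite !ffunE => /(enumf_inj cI).
rewrite big_distrl /=; apply: eq_big => [s|s _]; first by rewrite inE.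
rewrite (_ : rowsub _ _ = row_perm s (sel (@enumf k I))); last first.
  by apply/matrixP => i j; rewrite !mxE ffunE.
rewrite det_col_mx_row_perm mulrCA mulrA; congr (_ * _ * _).
by apply: eq_bigr => i _; rewrite !mxE ffunE.
Qed.

(** For [#|I| = k], the permutation matrix listing [I] and then its complement, both increasingly;
    its determinant is the sign of the term of [I] in the expansion. *)
Definition shuffle_mx I : 'M[R]_n :=
  col_mx (sel (@enumf k I)) (sel (@enumf p (~: I))).

Lemma mulmx_selT q (M : 'M[R]_(q, n)) r (f : 'I_r -> 'I_n) :
  M *m (sel f)^T = colsub f M.
Proof.
apply/matrixP => i j; rewrite !mxE (bigD1 (f j)) //= !mxE eqxx mulr1.
by rewrite big1 ?addr0 // => l nl; rewrite !mxE eq_sym (negPf nl) mulr0.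
Qed.

Lemma cardsC_add I : #|I| = k -> #|~: I| = p.
Proof. by move=> cI; apply/(@addnI k); rewrite -{1}cI cardsC card_ord. Qed.

Lemma colsub_sel q I : #|I| = q -> colsub (@enumf q I) (sel (@enumf q I)) = 1%:M.
Proof.
by move=> cI; apply/matrixP => i j; rewrite !mxE (inj_eq (enumf_inj cI)).
Qed.

(* Multiplying by the transpose of the permutation matrix [shuffle_mx I] makes the
   matrix block lower triangular, with an identity upper left block. *)
Lemma det_col_mx_shuffle I B : #|I| = k ->
  \det (col_mx (sel (@enumf k I)) B) * \det (shuffle_mx I) =
  \det (colsub (@enumf p (~: I)) B).
Proof.
move=> cI; have cIC := cardsC_add cI.
rewrite -[\det (shuffle_mx I)]det_tr -det_mulmx tr_col_mx mul_col_row.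
rewrite !mulmx_selT colsub_sel //.
rewrite (_ : colsub _ (sel _) = 0) ?det_lblock ?det1 ?mul1r //.
apply/matrixP => i j; rewrite !mxE; case: eqP => // eij.
by have := enumf_mem j cIC; rewrite inE -eij enumf_mem.
Qed.

Lemma det_shuffle_sqr I : #|I| = k -> \det (shuffle_mx I) * \det (shuffle_mx I) = 1.
Proof.
by move=> cI; rewrite det_col_mx_shuffle // colsub_sel ?det1 ?cardsC_add.
Qed.

Lemma laplace_shuffle A B :
  \det (col_mx A B) = \sum_(I : {set 'I_n} | #|I| == k) \det (shuffle_mx I) *
     (\det (colsub (@enumf k I) A) * \det (colsub (@enumf p (~: I)) B)).
Proof.
rewrite det_col_mx_sets; apply: eq_bigr => I /eqP cI.
rewrite mulrCA; congr (_ * _); rewrite -det_col_mx_shuffle // mulrC -mulrA.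
by rewrite det_shuffle_sqr ?mulr1.
Qed.

Lemma sorted_enum q (J : {pred 'I_q}) : sorted (fun i j : 'I_q => (i < j)%N) (enum J).
Proof.
rewrite /enum_mem sorted_filter //=; first by move=> ? ? ?; apply: ltn_trans.
by have := iota_ltn_sorted 0 q; rewrite -val_enum_ord sorted_map enumT.
Qed.

(** Both lists are strictly increasing and have the same members. *)
Lemma enum_imset_homo q r (f : 'I_q -> 'I_r) (J : {pred 'I_q}) :
  {in J &, forall a b : 'I_q, (a < b)%N -> (f a < f b)%N} ->
  enum (f @: J) = [seq f x | x <- enum J].
Proof.
move=> homof; apply: (@irr_sorted_eq _ (fun i j : 'I_r => (i < j)%N)).
- by move=> ? ? ?; apply: ltn_trans.
- by move=> ?; rewrite ltnn.
- exact: sorted_enum.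
- rewrite sorted_map; apply: (sub_in_sorted (P := mem J)) (sorted_enum J).
    exact: homof.
  by apply/allP => x; rewrite mem_enum.
- move=> x; rewrite mem_enum; apply/imsetP/mapP => -[y yJ ->]; exists y => //.
    by rewrite mem_enum.
  by rewrite mem_enum in yJ.
Qed.

(** An adjacent transposition reverses the order of the pair [i], [j] only, and this pair does not
    lie in [I]. *)
Lemma enum_tperm (i j : 'I_n) I : j = i.+1 :> nat -> ~~ ((i \in I) && (j \in I)) ->
  enum (tperm i j @: I) = [seq tperm i j x | x <- enum I].
Proof.
move=> ji nij; apply: enum_imset_homo => a b aI bI ltab.
have nea : ~ (a = i :> nat /\ b = j :> nat).
  by case=> /val_inj ai /val_inj bj; move: nij; rewrite -ai -bj aI bI.
have ne (x y : 'I_n) : x <> y -> x <> y :> nat by move=> nxy /val_inj.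
case: tpermP => [/(congr1 val)|/(congr1 val)|/ne nai /ne naj];
  case: tpermP => [/(congr1 val)|/(congr1 val)|/ne nbi /ne nbj] /=; lia.
Qed.

Lemma sel_tperm q I (i j : 'I_n) : #|I| = q ->
  j = i.+1 :> nat -> ~~ ((i \in I) && (j \in I)) ->
  sel (@enumf q (tperm i j @: I)) = sel (@enumf q I) *m perm_mx (tperm i j).
Proof.
move=> cI ji nij; rewrite -[tperm i j in RHS]invgK tpermV -col_permE.
apply/matrixP => a b; rewrite !mxE /enumf enum_tperm //.
rewrite (nth_map x0) -?cardE ?cI //.
by rewrite -[b in LHS](tpermK i j) (inj_eq perm_inj).
Qed.

(** Neither [I] nor its complement contains both [i] and [j], so both blocks are multiplied on the
    right by the same transposition matrix, of determinant -1. *)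
Lemma shuffle_tperm I (i j : 'I_n) : #|I| = k -> j = i.+1 :> nat ->
  j \in I -> i \notin I ->
  \det (shuffle_mx I) = - \det (shuffle_mx (tperm i j @: I)).
Proof.
move=> cI ji jI iI.
rewrite {2}/shuffle_mx (_ : ~: (tperm i j @: I) = tperm i j @: ~: I).
  rewrite !sel_tperm ?cardsC_add // ?inE ?(negPf iI) ?jI //.
  rewrite -mul_col_mx det_mulmx det_perm odd_tperm.
  by rewrite (_ : i != j) ?mulrN1 ?opprK // -val_eqE /= ji ltn_eqF.
apply/setP => x; rewrite inE -{1 2}(tpermK i j x).
by rewrite !(finset.mem_imset _ _ perm_inj) inE.
Qed.

Lemma det_shuffle I : #|I| = k ->
  \det (shuffle_mx I) = (-1) ^+ ((k * k.+1) %/ 2 + \sum_(i in I) i.+1).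
Proof.
have [d] := ubnP (\sum_(i in I) i.+1)%N; elim: d I => // d IHd I ltd cI.
(* Lowering some [j \in I] to an adjacent place outside [I] changes both signs;
   when this is impossible, [I] consists of the first [k] indices. *)
case: (pickP (fun ij : 'I_n * 'I_n =>
   [&& ij.2 == ij.1.+1 :> nat, ij.2 \in I & ij.1 \notin I])) => [[i j]|noij] /=.
  case/and3P => /eqP ji jI iI; rewrite (shuffle_tperm cI ji jI iI).
  have sumt : (\sum_(l in I) l.+1 = (\sum_(l in tperm i j @: I) l.+1).+1)%N.
    rewrite big_imset /=; last by move=> ? ? _ _; apply: perm_inj.
    rewrite !(bigD1 (P := mem I) j jI) /= tpermR ji -addSn; congr (_ + _)%N.
    apply: eq_bigr => l /andP[lI nl]; rewrite tpermD // eq_sym //.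
    by apply: contraNneq iI => <-.
  rewrite IHd ?card_imset //; [|by rewrite sumt in ltd|exact: perm_inj].
  by rewrite sumt addnS exprS mulN1r.
(* With no lowering possible, [I] is closed downwards. *)
have downI (i : 'I_n) l : i \in I -> (l <= i)%N ->
    forall Hl : (l < n)%N, Ordinal Hl \in I.
  move=> iI; move e : (i - l)%N => q; elim: q l e => [|q IHq] l e leli Hl.
    by rewrite (_ : Ordinal Hl = i) //; apply: val_inj => /=; lia.
  have Hl1 : (l.+1 < n)%N by have := ltn_ord i; lia.
  have : Ordinal Hl1 \in I by apply: IHq; lia.
  by move=> Hl1I; have := noij (Ordinal Hl, Ordinal Hl1); rewrite /= eqxx Hl1I => /negbFE.
have ltk i : i \in I -> (i < k)%N.
  move=> iI; suff: (i < #|I|)%N by rewrite cI.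
  have : [set widen_ord (ltn_ord i) x | x : 'I_i.+1] \subset I.
    apply/fintype.subsetP => _ /imsetP[x _ ->]; apply: (downI i) => //.
    by rewrite -ltnS ltn_ord.
  move/subset_leq_card; rewrite card_imset ?card_ord //.
  by move=> a b /(congr1 val) /= /val_inj.
have IE : I = [set lshift p x | x : 'I_k].
  apply/eqP; rewrite eqEcard card_imset ?card_ord ?cI ?leqnn ?andbT;
    last exact: lshift_inj.
  apply/fintype.subsetP => i iI; apply/imsetP; exists (Ordinal (ltk i iI)) => //.
  exact: val_inj.
have ICE : ~: I = [set rshift k x | x : 'I_p].
  apply/setP => i; rewrite inE IE -(splitK i).
  case: (split i) => j /=; first rewrite imset_f //=.
    by apply/esym/imsetP => -[x _ /eqP]; rewrite eq_lrshift.
  rewrite [RHS]imset_f //; apply/imsetP => -[x _ /eqP].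
  by rewrite eq_rlshift.
have sum_k : (\sum_(i < k) i.+1 = (k * k.+1) %/ 2)%N.
  elim: (k) => [|q IHq]; rewrite ?big_ord0 // big_ord_recr /= IHq.
  by rewrite addnC -divnMDl //; congr (_ %/ _)%N; lia.
(* For the first [k] indices the exponent is twice k(k+1)/2, hence even, and the shuffle matrix is
   the identity. *)
rewrite {2}IE big_imset /=; last by move=> ? ? _ _; apply: lshift_inj.
rewrite sum_k addnn -signr_odd odd_double expr0.
rewrite (_ : shuffle_mx I = 1%:M) ?det1 //.
apply/row_matrixP => i; rewrite -(splitK i); case: (split i) => j /=.
  rewrite rowKu; apply/rowP => l; rewrite !mxE.
  rewrite /enumf IE enum_imset_homo // (nth_map j) -?cardE ?card_ord //.
  by rewrite nth_ord_enum.
rewrite rowKd; apply/rowP => l; rewrite !mxE.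
rewrite /enumf ICE enum_imset_homo //; last by move=> a b _ _ /=; rewrite ltn_add2l.
by rewrite (nth_map j) -?cardE ?card_ord // nth_ord_enum.
Qed.

(** The sign now has the form used in [adjoint_coef]. *)
Lemma laplace A B :
  \det (col_mx A B) = \sum_(I : {set 'I_n} | #|I| == k)
     (-1) ^+ ((k * k.+1) %/ 2 + \sum_(i in I) i.+1) *
     (\det (colsub (@enumf k I) A) * \det (colsub (@enumf p (~: I)) B)).
Proof.
rewrite laplace_shuffle; apply: eq_bigr => I /eqP cI.
by rewrite det_shuffle.
Qed.
End Laplace.

(** * Plücker vectors on adjoint hyperplanes *)

Section Incidence.
Variable R : realType.

Lemma det_free (F : fieldType) N (s : N.-tuple 'rV[F]_N) :
  (\det (\matrix_(i < N, j < N) s`_i 0 j) != 0) = free s.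
Proof.
rewrite -unitfE -unitmxE -row_free_unit.
set M := \matrix_(i, j) _.
have mulM (c : 'rV_N) : c *m M = \sum_(i < N) c 0 i *: s`_i.
  by apply/rowP => j; rewrite !mxE summxE; apply: eq_bigr => i _; rewrite !mxE.
apply/idP/freeP => [/row_freeP[M' MM'] c c0 i|frs].
  have: \row_j c j *m M = 0.
    by rewrite mulM -[RHS]c0; apply: eq_bigr => j _; rewrite !mxE.
  move/(congr1 (mulmx^~ M')); rewrite -mulmxA MM' mulmx1 mul0mx => /rowP/(_ i).
  by rewrite !mxE.
apply: inj_row_free => v; rewrite mulM => /frs v0.
by apply/rowP => i; rewrite v0 mxE.
Qed.

Lemma big_ksubset (T : nmodType) n k (F : {set 'I_n} -> T) :
  \sum_(I : ksubset n k) F (val I) = \sum_(I : {set 'I_n} | #|I| == k) F I.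
Proof.
symmetry; rewrite (reindex_omap (val : ksubset n k -> _) insub) /=; last first.
  by move=> I cI; rewrite insubT.
by apply: eq_bigl => I; rewrite (valP I) valK eqxx.
Qed.

Lemma minorE (k p : nat) (x0 : 'I_(k + p)) q (s : seq 'rV[R]_(k + p))
    (I : {set 'I_(k + p)}) :
  #|I| = q ->
  minor s I = \det (colsub (@enumf k p x0 q I) (\matrix_(i < q, j < k + p) s`_i 0 j)).
Proof.
move=> <-; congr (\det _); apply/matrixP => i j; rewrite !mxE.
by rewrite (enum_val_nth x0).
Qed.

(** The matrix stacks a basis of [U] on a basis of [X]; its expansion pairs each minor of [U] with
    the signed complementary minor of [X], which is the adjoint coefficient. *)
Lemma adjoint_form_det k p (U X : {vspace 'rV[R]_(k + p)}) :
  \dim U = k -> \dim X = p -> (0 < k + p)%N ->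
  \sum_I adjoint_coef X I * plucker_vec k U I =
  \det (\matrix_(i < k + p, j < k + p) (vbasis U ++ vbasis X)`_i 0 j).
Proof.
move=> dU dX np; pose x0 := Ordinal np.
rewrite (_ : \matrix_(i, j) _ = col_mx (\matrix_(i < k, j < k + p) (vbasis U)`_i 0 j)
   (\matrix_(i < p, j < k + p) (vbasis X)`_i 0 j)); last first.
  apply/row_matrixP => i; rewrite -(splitK i); case: (split i) => l /=;
    rewrite ?rowKu ?rowKd; apply/rowP => j; rewrite !mxE;
    rewrite nth_cat (_ : size (vbasis U) = k) ?size_tuple //=.
    by rewrite ltn_ord.
  by rewrite ltnNge leq_addr /= addKn.
rewrite (laplace x0) -big_ksubset; apply: eq_bigr => I _.
have cI : #|val I| = k by apply/eqP; apply: (valP I).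
rewrite ffunE /adjoint_coef /plucker.
rewrite (minorE x0 _ cI) (minorE x0 _ (cardsC_add cI)).
by rewrite -mulrA; congr (_ * _); rewrite mulrC.
Qed.

(** The determinant of the stacked bases vanishes iff they are linearly dependent together, that is,
    iff the sum of [U] and [X] is not direct. *)
Lemma plucker_adjoint n k (U X : {vspace 'rV[R]_n}) :
  (k < n)%N -> \dim U = k -> \dim X = (n - k)%N ->
  (plucker_vec k U \in adjoint_hyperplane k X) = (U :&: X != 0)%VS.
Proof.
move=> ltkn; have [p def_n] : exists p, n = (k + p)%N.
  by exists (n - k)%N; rewrite subnKC // ltnW.
subst n; rewrite addKn => dU dX.
rewrite mem_adjoint_hyperplane adjoint_form_det //; last exact: leq_ltn_trans ltkn.
have sz : size (vbasis U ++ vbasis X) == (k + p)%N.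
  by rewrite size_cat !size_tuple dU dX.
rewrite -[LHS]negbK -[_ ++ _]/(tval (Tuple sz)) det_free /= cat_free.
rewrite !(basis_free (vbasisP _)) !(span_basis (vbasisP _)) /=.
by congr (~~ _); apply/directv_addP/eqP.
Qed.

End Incidence.

(** * Matroid rank functions and their bases *)

Section MatroidRank.
Variable m : nat.
Implicit Types (r : {ffun {set 'I_m} -> nat}) (I J B : {set 'I_m}).

(** Extension of an independent set to a basis of [I]: a maximal independent [B] between [J] and [I]
    will do, since by maximality no single element of [I] raises its rank. *)
Lemma matroid_independent_ext r I J : is_matroid_rank r ->
  J \subset I -> r J = #|J| ->
  exists B, [/\ J \subset B, B \subset I, r B = #|B| & r B = r I].
Proof.
case/and3P => /forallP cardr /forallP monor /forallP subr JI rJ.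
have mono (K L : {set 'I_m}) : K \subset L -> (r K <= r L)%N.
  by move=> KL; have /forallP/(_ L)/implyP/(_ KL) := monor K.
have subm (K L : {set 'I_m}) : (r (K :|: L)%SET + r (K :&: L)%SET <= r K + r L)%N.
  by have /forallP/(_ L) := subr K.
pose P (B : {set 'I_m}) := [&& J \subset B, B \subset I & r B == #|B|].
have PJ : P J by rewrite /P subxx JI rJ eqxx.
have [B /maxsetP[/and3P[JB BI /eqP rB] maxB] _] := maxset_exists PJ.
exists B; split=> //.
have rBi i : i \in I -> (r (i |: B) <= r B)%N.
  move=> iI; have [iB|iB] := boolP (i \in B).
    by rewrite (finset.setUidPr _) // finset.sub1set.
  have := subm [set i]%SET B; have := cardr [set i]%SET; rewrite cards1 => r1 rS.
  have cU : #|(i |: B)%SET| = #|B|.+1 by rewrite cardsU1 iB.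
  have := cardr (i |: B)%SET; rewrite cU leq_eqVlt => /orP[/eqP rU|]; last first.
    by rewrite ltnS rB.
  suff /maxB/(_ (finset.subsetUr _ _)) : P (i |: B)%SET.
    by move=> eB; move: iB; rewrite -eB finset.setU11.
  rewrite /P rU cU eqxx andbT finset.subUset finset.sub1set iI BI !andbT.
  by apply: fintype.subset_trans JB (finset.subsetUr _ _).
(* From single elements to all of [I]: submodularity for [i |: B] and [D], whose intersection
   contains [B], shows that adding [i] to [D] keeps the rank at most [r B]. A maximal such [D]
   therefore contains [I]. *)
pose Q (D : {set 'I_m}) := [&& B \subset D, D \subset I & (r D <= r B)%N].
have QB : Q B by rewrite /Q subxx BI leqnn.
have [D /maxsetP[/and3P[BD DI rD] maxD] _] := maxset_exists QB.
suff ID : I \subset D by apply/eqP; rewrite eqn_leq mono // (leq_trans (mono _ _ ID)).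
apply/fintype.subsetP => i iI.
suff /maxD/(_ (finset.subsetUr _ _)) <- : Q (i |: D)%SET by rewrite finset.setU11.
rewrite /Q finset.subUset finset.sub1set iI DI andbT /=.
rewrite (fintype.subset_trans BD (finset.subsetUr _ _)) /=.
have := subm (i |: B)%SET D.
rewrite -finset.setUA (finset.setUidPr BD) => S.
have : (r B <= r ((i |: B) :&: D)%SET)%N.
  by apply: mono; rewrite finset.subsetI finset.subsetUr BD.
by have := rBi i iI; lia.
Qed.

(** A maximal [r]-independent subset [J] of [I] extends to a basis [B] of [r]. As [B] is independent
    for [r'], so is [J], whence [r I = #|J| = r' J <= r' I]. *)
Lemma matroid_rank_le_bases r r' : is_matroid_rank r -> is_matroid_rank r' ->
  (forall B, r B = #|B| -> r B = r finset.setT -> r' B = #|B|) ->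
  forall I, (r I <= r' I)%N.
Proof.
move=> Mr Mr' bases I; have /and3P[/forallP cardr' /forallP mono' /forallP sub'] := Mr'.
have r0 : r finset.set0 = #|(finset.set0 : {set 'I_m})|.
  have /and3P[/forallP /(_ finset.set0)] := Mr.
  by rewrite cards0 leqn0 => /eqP.
have [J [_ JI rJ <-]] := matroid_independent_ext Mr (finset.sub0set I) r0.
have [B [JB _ rB rT]] := matroid_independent_ext Mr (finset.subsetT J) rJ.
have r'B := bases B rB rT.
have /forallP/(_ I)/implyP/(_ JI) := mono' J; apply: leq_trans.
have /forallP/(_ (B :\: J)%SET) := sub' J; have := cardr' (B :\: J)%SET.
rewrite cardsD (finset.setIidPr JB) (_ : (J :|: B :\: J)%SET = B); last first.
  by apply/setP => x; rewrite !inE; case: (boolP (x \in J)) => // /(fintype.subsetP JB)->.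
have := subset_leq_card JB; rewrite r'B rJ; lia.
Qed.

End MatroidRank.

(** * Strata as classes of a relation *)

Section Strata.
Local Open Scope classical_set_scope.
Variables (T I : Type) (G : set T) (D : set I) (F : I -> set T).

Lemma decompositionP :
    (forall i U, D i -> F i U -> G U) ->
    (forall U, G U -> exists2 i, D i & F i U) ->
    (forall i j U, D i -> D j -> F i U -> F j U -> i = j) ->
  decomposition G D F.
Proof.
move=> FG GF Finj; split.
  apply/seteqP; split=> [U [i Di FiU]|U /GF[i Di FiU]]; first exact: FG FiU.
  by exists i.
by move=> i j Di Dj [U [FiU FjU]]; apply: Finj FiU FjU.
Qed.

(** The right-hand side depends on [G] and [e] only, so families whose strata are the classes of one
    relation have the same nonempty strata. *)
Lemma nonempty_strataE (e : T -> T -> Prop) :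
    (forall i U, D i -> F i U -> G U) ->
    (forall U, G U -> exists2 i, D i & F i U) ->
    (forall i U V, D i -> F i U -> G V -> F i V <-> e U V) ->
  nonempty_strata D F = [set [set V | G V /\ e U V] | U in G].
Proof.
move=> FG GF Fe.
have FE i U : D i -> F i U -> F i = [set V | G V /\ e U V].
  move=> Di FiU; apply/seteqP; split=> [V FiV|V [GV /Fe]].
    have GV := FG _ _ Di FiV; split=> //; exact/(Fe i U V).
  exact.
apply/seteqP; split=> [S [[U SU] [i Di FiS]]|_ [U GU <-]].
  have FiU : F i U by rewrite FiS.
  by exists U; [exact: FG FiU | rewrite -FiS (FE _ _ Di FiU)].
have [i Di FiU] := GF U GU; rewrite -(FE i U Di FiU); split; first by exists U.
by exists i.
Qed.

End Strata.

(** * The smallest flat containing a vector *)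

Section MinimalFlat.
Variables (R : realType) (V : vectType R).
Implicit Types (A C : {fset {vspace V}}) (X Y : {vspace V}) (v : V).

Definition min_flat A v : {vspace V} :=
  (\bigcap_(K <- [fset K in A | v \in K]%fset) K)%VS.

Lemma min_flat_lattice A v : min_flat A v \in intersection_lattice A.
Proof.
apply/flatP; exists [fset K in A | v \in K]%fset => //.
by apply/fsubsetP => K; rewrite !inE => /andP[].
Qed.

Lemma mem_bigcapv (B : {fset {vspace V}}) v :
  v \in (\bigcap_(K <- B) K)%VS <-> forall K, K \in B -> v \in K.
Proof. by rewrite memvE subv_bigcapE; split => [/allP|? ]; last apply/allP. Qed.

Lemma mem_min_flat A v : v \in min_flat A v.
Proof. by apply/mem_bigcapv => K; rewrite !inE => /andP[]. Qed.

Lemma min_flat_le A X v : X \in intersection_lattice A -> v \in X ->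
  (min_flat A v <= X)%VS.
Proof.
case/flatP => B /fsubsetP BA -> /mem_bigcapv vB.
rewrite subv_bigcapE; apply/allP => K KB; apply: bigcapv_le.
by rewrite !inE /= BA ?vB.
Qed.

(** If [v] lies in [X], its smallest flat is contained in [X]; if properly, it is one of the flats
    removed from [X]. *)
Lemma open_stratumP A X v : X \in intersection_lattice A ->
  open_stratum A X v <-> X = min_flat A v.
Proof.
move=> XL; split=> [[/= vX nY]|->].
  apply/eqP; apply: contra_notT nY => nX; exists (min_flat A v) => /=.
    by rewrite min_flat_lattice min_flat_le //= eq_sym.
  exact: mem_min_flat.
split; first exact: mem_min_flat.
case=> Y /= /and3P[YL leY nY] vY; case/negP: nY.
by rewrite eqEsubv leY min_flat_le.
Qed.

Lemma flat_of_hyperplane A K : K \in A -> K \in intersection_lattice A.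
Proof.
move=> KA; have := flat_capH (flatT A) KA.
by have /capv_idPr -> := subvf K.
Qed.

(** Each hyperplane of [A] is itself a flat, so it contains [v] iff it contains the smallest flat of
    [v]. *)
Lemma min_flat_eq A v w :
  min_flat A v = min_flat A w <-> forall K, K \in A -> (v \in K) = (w \in K).
Proof.
split=> [evw K KA|evw].
  have KL := flat_of_hyperplane KA.
  apply/idP/idP => inK; have := min_flat_le KL inK.
    by rewrite evw => /subvP; apply; apply: mem_min_flat.
  by rewrite -evw => /subvP; apply; apply: mem_min_flat.
rewrite /min_flat.
suff -> : [fset K in A | v \in K]%fset = [fset K in A | w \in K]%fset by [].
apply/fsetP => K; rewrite !inE /=.
by case: (boolP (K \in A)) => //= /evw ->.
Qed.

End MinimalFlat.

(** * Maximal chains through a given flat *)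

Section MaximalChains.
Variables (R : realType) (V : vectType R) (A : {fset {vspace V}}).
Implicit Types (C D : {fset {vspace V}}) (X Y : {vspace V}).

Lemma chains_lattice C X : C \in chains A -> X \in C -> X \in intersection_lattice A.
Proof.
by rewrite !inE /= fpowersetE => /andP[/fsubsetP sCL _]; apply: sCL.
Qed.

Lemma max_chain_lattice C X :
  C \in max_chains A -> X \in C -> X \in intersection_lattice A.
Proof.
by rewrite !inE /= fpowersetE => /andP[/andP[/fsubsetP sCL _] _]; apply: sCL.
Qed.

(** Among the chains containing [X], such as the singleton, one of largest cardinality is maximal,
    because any larger chain would still contain [X]. *)
Lemma max_chain_through X : X \in intersection_lattice A ->
  exists2 C, C \in max_chains A & X \in C.
Proof.
move=> XL; pose P d := has (fun C => (X \in C) && (#|` C|%fset == d)) (chains A).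
have exP : exists d, P d.
  exists 1%N; apply/hasP; exists [fset X]%fset; last by rewrite inE eqxx cardfs1.
  rewrite !inE /= fpowersetE fsub1set XL.
  by apply/allrelP => Y Z; rewrite !inE => /eqP -> /eqP ->; rewrite subvv.
have leP d : P d -> (d <= #|` intersection_lattice A|)%N.
  case/hasP => C CA /andP[_ /eqP <-]; apply: fsubset_leq_card.
  by apply/fsubsetP => Y; apply: chains_lattice CA.
have [d /hasP[C CA /andP[XC /eqP dC]] maxd] := ex_maxnP exP leP.
exists C => //; rewrite !inE /=; move: (CA); rewrite !inE /= => -> /=.
apply/hasPn => D DA; apply/negP => CD.
have := fproper_ltn_card CD; rewrite ltnNge => /negP; apply.
rewrite dC; apply: maxd; apply/hasP; exists D => //.
by rewrite (fsubsetP (fproper_sub CD) _ XC) eqxx.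
Qed.

End MaximalChains.

(** * Schubert cells and dimension jumps along a flag *)

Section FlagJumps.
Variables (R : realType) (n k : nat) (F : nat -> {vspace 'rV[R]_n}).
Hypothesis flagF : complete_flag F.
Implicit Types (U X : {vspace 'rV[R]_n}) (tau : ksubset n k).

Lemma dim_rowspace : \dim {:'rV[R]_n} = n.
Proof. by rewrite dimvf dim_matrix mul1r. Qed.

(** The Schubert symbol of [U] for the flag. The ordinal [i] stands for the element [i + 1] of [n],
    hence the step from [F i] to [F i.+1]. *)
Definition jumps U : {set 'I_n} :=
  [set i : 'I_n | (\dim (U :&: F i) < \dim (U :&: F i.+1))%N].

Lemma dim_flag_jumps U j : (j <= n)%N ->
  \dim (U :&: F j) = (\sum_(i < n | (i < j)%N) (i \in jumps U))%N.
Proof.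
case: flagF => dimF subF; rewrite dim_rowspace in dimF subF.
elim: j => [|j IHj] ltj.
  rewrite big_pred0 //; apply/eqP.
  by have := dimvS (capvSr U (F 0%N)); rewrite dimF // leqn0.
rewrite (bigD1 (Ordinal ltj)) //= inE /=.
rewrite (eq_bigl (fun i : 'I_n => (i < j)%N)); last first.
  by move=> i; rewrite -val_eqE /= ltnS; case: ltngtP.
rewrite -(IHj (ltnW ltj)).
have le1 : (\dim (U :&: F j) <= \dim (U :&: F j.+1))%N.
  by apply: dimvS; apply: capvS; rewrite ?subF.
(* The sum of [U :&: F j.+1] and [F j] stays inside [F j.+1], so a step adds at most one
   dimension. *)
have le2 : (\dim (U :&: F j.+1) <= (\dim (U :&: F j)).+1)%N.
  have := dimv_sum_cap (U :&: F j.+1) (F j).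
  rewrite -capvA (capv_idPr (subF _ ltj)) (dimF _ (ltnW ltj)) => S.
  have : (\dim (U :&: F j.+1 + F j) <= j.+1)%N.
    rewrite -[X in (_ <= X)%N](dimF _ ltj); apply: dimvS.
    by rewrite subv_add capvSr subF.
  lia.
case: ltnP; lia.
Qed.

Lemma card_jumps U : #|jumps U| = \dim U.
Proof.
have := dim_flag_jumps U (leqnn n).
have -> : F n = fullv.
  apply/eqP; rewrite eqEdim subvf dim_rowspace.
  by case: flagF => dimF _; rewrite dimF ?dim_rowspace leqnn.
rewrite capvf => ->; rewrite -sum1_card big_mkcond [RHS]big_mkcond /=.
by apply: eq_bigr => i _; rewrite ltn_ord; case: (i \in _).
Qed.

(** The cell only asks that [tau] consist of jumps, but both sets have [k] elements. *)
Lemma schubert_cellP U tau : Gr k U ->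
  schubert_cell F tau U <-> val tau = jumps U.
Proof.
rewrite /Gr /= => dU; split=> [[_ tauU]|etau].
  apply/eqP; rewrite eqEcard card_jumps dU (eqP (valP tau)) leqnn andbT.
  by apply/fintype.subsetP => i /tauU; rewrite inE.
split=> // i itau; have : i \in jumps U by rewrite -etau.
by rewrite inE.
Qed.

End FlagJumps.

(** [U :&: orthv W] is the orthogonal complement of [W] inside [U]. *)
Lemma dim_cap_orthv (R : realType) n (U W : {vspace 'rV[R]_n}) : (W <= U)%VS ->
  (\dim W + \dim (U :&: orthv W))%N = \dim U.
Proof.
move=> WU; have := dimv_sum_cap U (orthv W).
have -> : (U + orthv W = fullv)%VS.
  by apply/eqP; rewrite eqEsubv subvf -(addv_orthv W) addvS.
have := dimv_disjoint_sum (capv_orthv W); rewrite addv_orthv => ->.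
by move=> S; apply/(@addIn (\dim (orthv W))); rewrite -S addnAC.
Qed.

(** * The three kinds of strata and the dimensions of intersections with flats *)

Section Main.
Variables (R : realType) (n m : nat).
Variables (H : 'I_m -> {vspace 'rV[R]_n}) (alpha : 'I_m -> 'rV[R]_n).
Local Notation E := ('rV[R]_n).
Local Notation A := ([fset H i | i in 'I_m]%fset : {fset {vspace E}}).
Implicit Types (U X : {vspace E}) (I : {set 'I_m}).

(** Flats are indexed by sets of labels, like the ranks of the matroid on [m]; different sets may
    give the same flat. *)
Definition flat I : {vspace E} := (\bigcap_(i in I) H i)%VS.

Lemma flat_lattice I : flat I \in intersection_lattice A.
Proof.
apply/flatP; exists [fset H i | i in I]%fset.
  by apply/fsubsetP => _ /imfsetP[i _ ->]; apply/imfsetP; exists i.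
apply/eqP; rewrite eqEsubv subv_bigcapE; apply/andP; split.
  by apply/allP => _ /imfsetP[i /= iI ->]; apply: bigcapv_inf (subvv _).
by apply/subv_bigcapP => i iI; apply: bigcapv_le; apply/imfsetP; exists i.
Qed.

Lemma lattice_flat X : X \in intersection_lattice A -> exists I, X = flat I.
Proof.
case/flatP => B /fsubsetP BA ->; exists [set i | H i \in B]%SET.
apply/eqP; rewrite eqEsubv subv_bigcapE; apply/andP; split.
  by apply/subv_bigcapP => i; rewrite inE => iB; apply: bigcapv_le.
apply/allP => K KB; have /imfsetP[i _ Ki] := BA _ KB; subst K.
by apply: (bigcapv_inf i); rewrite ?inE.
Qed.

Hypothesis normal : forall i, normal_vector (alpha i) (H i).

Lemma mem_flat I v : v \in flat I <-> forall i, i \in I -> dotp (alpha i) v = 0.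
Proof.
rewrite memvE; split=> [/subv_bigcapP vI i /vI|vI].
  by rewrite -memvE normal => /eqP.
by apply/subv_bigcapP => i /vI vi; rewrite -memvE normal vi.
Qed.

(** On [U] a normal vector and its projection have the same inner products, so [U :&: flat I] is the
    orthogonal complement in [U] of the span of the projections. *)
Lemma proj_rank_dim U I : (proj_rank alpha U I + \dim (U :&: flat I))%N = \dim U.
Proof.
rewrite ffunE; set W := <<_>>%VS.
have WU : (W <= U)%VS.
  by apply/span_subvP => _ /mapP[i _ ->]; apply: orthoproj_mem.
rewrite -[RHS](dim_cap_orthv WU); congr (_ + \dim _)%N.
have dotpE v i : v \in U -> dotp (orthoproj U (alpha i)) v = dotp (alpha i) v.
  move=> vU; have := orthoproj_orth (alpha i) vU; rewrite linearB /= => /subr0_eq.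
  by rewrite dotpC => ->; rewrite dotpC.
apply/vspaceP => v; rewrite !memv_cap; have [vU /=|//] := boolP (v \in U).
apply/idP/orthvP => [/mem_flat vI w wW|vW].
  suff: (W <= lker (linfun (dotp v)))%VS.
    by move/subvP/(_ w wW); rewrite memv_ker lfunE /= dotpC => /eqP.
  apply/span_subvP => _ /mapP[i iI ->]; rewrite mem_enum in iI.
  by rewrite memv_ker lfunE /= dotpC dotpE // vI.
apply/mem_flat => i iI; rewrite -dotpE //; apply: vW.
by apply/memv_span/map_f; rewrite mem_enum.
Qed.

(** The relation on the Grassmannian whose classes are the strata of all three decompositions. *)
Definition same_dims U V := forall X, X \in intersection_lattice A ->
  \dim (U :&: X) = \dim (V :&: X).

Lemma proj_rank_eq U V : \dim U = \dim V ->
  proj_rank alpha U = proj_rank alpha V <-> same_dims U V.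
Proof.
move=> dUV; split=> [eR X /lattice_flat[I ->]|eD].
  have := proj_rank_dim U I; have := proj_rank_dim V I.
  by rewrite eR; lia.
apply/ffunP => I; apply/(@addIn (\dim (U :&: flat I))).
by rewrite proj_rank_dim eD ?flat_lattice // proj_rank_dim.
Qed.

Lemma proj_matroid_eq U V : \dim U = \dim V ->
  proj_matroid alpha U = proj_matroid alpha V <-> same_dims U V.
Proof.
move=> dUV; rewrite -proj_rank_eq //; split=> [|eR].
  exact: (congr1 (@matroid_rank m)).
rewrite /proj_matroid; move: (proj_rank_subproof alpha U) (proj_rank_subproof alpha V).
by rewrite eR => p q; rewrite (bool_irrelevance p q).
Qed.

Hypothesis essA : essential A.

Lemma flat_setT : flat finset.setT = 0%VS.
Proof.
apply/eqP; rewrite -subv0 -essA subv_bigcapE.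
by apply/allP => _ /imfsetP[i _ ->]; apply: (bigcapv_inf i); rewrite ?inE.
Qed.

Lemma proj_rankT U : proj_rank alpha U finset.setT = \dim U.
Proof. by have := proj_rank_dim U finset.setT; rewrite flat_setT capv0 dimv0 addn0. Qed.

Lemma codim_flat I : (n <= #|I| + \dim (flat I))%N.
Proof.
have := proj_rank_dim fullv I; rewrite capfv dim_rowspace => S.
rewrite -[leqLHS]S leq_add2r.
by have /and3P[/forallP] := proj_rank_subproof alpha fullv.
Qed.

Variable k : nat.
Hypothesis ltkn : (k < n)%N.

(** The hypothesis is symmetric, so one inequality of rank functions suffices, and it is checked on
    bases. *)
Lemma same_dims_rank_flats U V : Gr k U -> Gr k V ->
  (forall X, X \in rank_flats A k -> (U :&: X == 0)%VS = (V :&: X == 0)%VS) ->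
  same_dims U V.
Proof.
rewrite /Gr /= => dU dV eUV.
have le U1 U2 : \dim U1 = k -> \dim U2 = k ->
    (forall X, X \in rank_flats A k -> (U1 :&: X == 0)%VS = (U2 :&: X == 0)%VS) ->
    forall I, (proj_rank alpha U1 I <= proj_rank alpha U2 I)%N.
  move=> d1 d2 e12; apply: matroid_rank_le_bases; try exact: proj_rank_subproof.
  move=> B rB; rewrite proj_rankT d1 => rk; rewrite rk in rB.
  have := proj_rank_dim U1 B; rewrite rk d1 -{2}(addn0 k) => /addnI/eqP.
  rewrite dimv_eq0 => cap0.
  (* The codimension of [flat B] is at most [#|B| = k], and at least [k] because the flat meets the
     [k]-space [U1] trivially. *)
  have : flat B \in rank_flats A k.
    rewrite !inE /= flat_lattice dim_rowspace /=; apply/eqP.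
    have := codim_flat B; rewrite -rB.
    have := dimv_disjoint_sum (eqP cap0); have := dimvS (subvf (U1 + flat B)).
    by rewrite dim_rowspace d1; lia.
  move/e12; rewrite cap0 => /esym; rewrite -dimv_eq0 => /eqP cap2.
  by have := proj_rank_dim U2 B; rewrite cap2 addn0 d2 -rB.
have leUV := le _ _ dU dV eUV.
have leVU : forall I, (proj_rank alpha V I <= proj_rank alpha U I)%N.
  by apply: le => // X /eUV.
apply/proj_rank_eq; rewrite ?dU ?dV //.
by apply/ffunP => I; apply/eqP; rewrite eqn_leq leUV leVU.
Qed.

Lemma adjoint_stratumP P U : P \in intersection_lattice (adjoint k A) ->
  adjoint_stratum A P U <-> Gr k U /\ P = min_flat (adjoint k A) (plucker_vec k U).
Proof. by move=> PL; split=> -[GU /(open_stratumP _ PL)]. Qed.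

(** By [plucker_adjoint], both Plücker vectors lie on the same adjoint hyperplanes iff [U] and [V]
    meet the same rank [k] flats trivially. *)
Lemma min_flat_plucker U V : Gr k U -> Gr k V ->
  min_flat (adjoint k A) (plucker_vec k U) = min_flat (adjoint k A) (plucker_vec k V)
  <-> same_dims U V.
Proof.
move=> GU GV; rewrite min_flat_eq.
have dimX X : X \in rank_flats A k -> \dim X = (n - k)%N.
  rewrite !inE /= dim_rowspace => /andP[_ /eqP]; have := dimvS (subvf X).
  by rewrite dim_rowspace; lia.
split=> [eK|eD K /imfsetP[X /= XL ->]].
  apply: same_dims_rank_flats => // X XL; apply/negb_inj.
  rewrite -(plucker_adjoint ltkn GU (dimX X XL)) -(plucker_adjoint ltkn GV (dimX X XL)).
  by apply: eK; apply/imfsetP; exists X.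
rewrite (plucker_adjoint ltkn GU (dimX X XL)) (plucker_adjoint ltkn GV (dimX X XL)).
rewrite -!dimv_eq0 eD //.
by move: XL; rewrite !inE => /andP[].
Qed.

Hypothesis hypH : forall i, is_hyperplane (H i).

Lemma max_chain_flagA C : C \in max_chains A ->
  complete_flag (chain_flag C) /\
  (forall X, X \in C <-> exists2 i, (i <= n)%N & X = chain_flag C i).
Proof.
move=> CA; have [|flagC memC] := max_chain_flag _ essA CA.
  by move=> K /imfsetP[i _ ->].
by rewrite dim_rowspace in memC.
Qed.

Lemma schubert_stratumP (sigma : {ffun max_chains A -> ksubset n k}) U :
  schubert_stratum sigma U <->
  Gr k U /\ forall C : max_chains A, val (sigma C) = jumps (chain_flag (val C)) U.
Proof.
split=> [sU|[GU sU] C _]; last first.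
  by apply/schubert_cellP => //; have [] := max_chain_flagA (valP C).
(* An empty intersection of cells would not force [U] into the Grassmannian, so some maximal chain
   must be exhibited. *)
have [C0 C0A _] := max_chain_through (flatT A).
have GU : Gr k U by case: (sU (FSetSub C0A) I).
split=> // C; apply/(schubert_cellP _ _ GU); first by have [] := max_chain_flagA (valP C).
exact: sU.
Qed.

(** Every flat is a step of some maximal chain, where the dimension counts jumps; conversely all
    steps of a maximal chain are flats. *)
Lemma jumps_eq U V :
  (forall C : max_chains A, jumps (chain_flag (val C)) U = jumps (chain_flag (val C)) V)
  <-> same_dims U V.
Proof.
split=> [eJ X XL|eD C].
  have [C CA XC] := max_chain_through XL.
  have [flagC memC] := max_chain_flagA CA.
  have /memC[i lei ->] := XC.
  by rewrite !dim_flag_jumps //; have /= -> := eJ (FSetSub CA).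
have [flagC memC] := max_chain_flagA (valP C).
have eF i : (i <= n)%N ->
    \dim (U :&: chain_flag (val C) i) = \dim (V :&: chain_flag (val C) i).
  move=> lei; apply: eD; apply: (max_chain_lattice (valP C)); apply/memC; by exists i.
by apply/setP => i; rewrite !inE !eF // ltnW.
Qed.

End Main.

(** * Comparison of the three decompositions *)

Local Open Scope classical_set_scope.

Theorem theorem1p2 (R : realType) (n m k : nat)
    (H : 'I_m -> {vspace 'rV[R]_n}) (alpha : 'I_m -> 'rV[R]_n) :
  let A : {fset {vspace 'rV[R]_n}} := [fset H i | i in 'I_m]%fset in
  (k < n)%N ->
  (forall i, is_hyperplane (H i)) ->
  (forall i, normal_vector (alpha i) (H i)) ->
  essential A ->
  [/\ decomposition (@Gr R n k)
        (proj_matroids k alpha) (matroid_stratum k alpha),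
      decomposition (@Gr R n k)
        [set` intersection_lattice (adjoint k A)] (@adjoint_stratum R n k A),
      decomposition (@Gr R n k)
        (@schubert_symbols R n k A) (@schubert_stratum R n k A),
      nonempty_strata (proj_matroids k alpha) (matroid_stratum k alpha) =
      nonempty_strata [set` intersection_lattice (adjoint k A)]
        (@adjoint_stratum R n k A)
    & nonempty_strata [set` intersection_lattice (adjoint k A)]
        (@adjoint_stratum R n k A) =
      nonempty_strata (@schubert_symbols R n k A) (@schubert_stratum R n k A)].
Proof.
move=> A ltkn hypH normal essA.
(* For each family it is shown that the strata lie in the Grassmannian, cover it, and are classes of
   [e]. *)
pose e := same_dims H.
have matG M U : proj_matroids k alpha M -> matroid_stratum k alpha M U -> Gr k U.
  by move=> _ [].
have matI U : Gr k U -> exists2 M, proj_matroids k alpha M & matroid_stratum k alpha M U.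
  by move=> GU; exists (proj_matroid alpha U) => //; exists U.
have matE M U V : proj_matroids k alpha M -> matroid_stratum k alpha M U ->
    Gr k V -> matroid_stratum k alpha M V <-> e U V.
  move=> _ [GU <-] GV; rewrite /e -(proj_matroid_eq normal) ?GU ?GV //.
  by split=> [[]|].
have adjG P U : [set` intersection_lattice (adjoint k A)] P ->
    adjoint_stratum A P U -> Gr k U by move=> _ [].
have adjI U : Gr k U -> exists2 P, [set` intersection_lattice (adjoint k A)] P &
    @adjoint_stratum R n k A P U.
  move=> GU; have PL := min_flat_lattice (adjoint k A) (plucker_vec k U).
  by exists (min_flat (adjoint k A) (plucker_vec k U)) => //; apply/adjoint_stratumP.
have adjE P U V : [set` intersection_lattice (adjoint k A)] P ->
    adjoint_stratum A P U -> Gr k V -> adjoint_stratum A P V <-> e U V.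
  move=> PL /(adjoint_stratumP _ PL)[GU ->] GV.
  rewrite (adjoint_stratumP _ (min_flat_lattice _ _)).
  by rewrite /e -(min_flat_plucker normal essA ltkn GU GV); split=> [[]|].
have schG s U : @schubert_symbols R n k A s -> schubert_stratum s U -> Gr k U.
  by move=> _ /(schubert_stratumP essA hypH)[].
have schI U : Gr k U -> exists2 s, @schubert_symbols R n k A s & schubert_stratum s U.
  move=> GU; have cardJ (C : max_chains A) : #|jumps (chain_flag (val C)) U| == k.
    by rewrite card_jumps ?GU //; have [] := max_chain_flagA essA hypH (valP C).
  (* The symbol of [U] records its jumps along every maximal chain; its stratum is nonempty because
     it contains [U]. *)
  pose s := [ffun C : max_chains A =>
    Sub (jumps (chain_flag (val C)) U) (cardJ C) : ksubset n k].
  have sU : schubert_stratum s U.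
    by apply/schubert_stratumP => //; split=> // C; rewrite ffunE.
  by exists s => //; exists U.
have schE s U V : @schubert_symbols R n k A s -> schubert_stratum s U ->
    Gr k V -> schubert_stratum s V <-> e U V.
  move=> _ /(schubert_stratumP essA hypH)[GU sU] GV.
  rewrite (schubert_stratumP essA hypH) /e -(jumps_eq essA hypH).
  by split=> [[_ sV] C|eJ]; [rewrite -sU -sV | split=> // C; rewrite sU eJ].
(* Disjointness holds because an index is recovered from any member of its stratum. *)
split.
- by apply: decompositionP => // M N U _ _ [_ <-] [].
- apply: decompositionP => // P Q U PL QL.
  by move=> /(adjoint_stratumP _ PL)[_ ->] /(adjoint_stratumP _ QL)[_ ->].
- apply: decompositionP => // s t U _ _.
  move=> /(schubert_stratumP essA hypH)[_ sU] /(schubert_stratumP essA hypH)[_ tU].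
  by apply/ffunP => C; apply: val_inj; rewrite sU tU.
- by rewrite (nonempty_strataE matG matI matE) (nonempty_strataE adjG adjI adjE).
- by rewrite (nonempty_strataE adjG adjI adjE) (nonempty_strataE schG schI schE).
Qed.
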